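(* Let $(\gamma,\lambda/\mu)$ be a placed skew shape with $n$ boxes and let $$J=\left\{\varepsilon_j-\varepsilon_i\ \middle|\ j>i,\ \mathrm{box}_j\text{ and }\mathrm{box}_i\text{ are in adjacent diagonals, and }\mathrm{box}_j\text{ is northwest of }\mathrm{box}_i\right\},$$ where northwest means strictly north and weakly west. Let $\mathcal F^{\lambda/\mu}$ be the set of standard tableaux of shape $\lambda/\mu$. Then the map $$\mathcal F^{\lambda/\mu}\longrightarrow\mathcal F^{(\gamma,J)},\qquad p\longmapsto w_p,$$ where $w_p\in S_n$ is the permutation $w_p(i)=p(\mathrm{box}_i)$, is a bijection.
   Context: Root system: $\varepsilon_1,\dots,\varepsilon_n$ is the standard orthonormal basis of $\mathbb R^n$; $R=\{\pm(\varepsilon_j-\varepsilon_i)\mid 1\le i<j\le n\}$, $R^+=\{\varepsilon_j-\varepsilon_i\mid1\le i<j\le n\}$, and $W=S_n$ acts by $w\varepsilon_i=\varepsilon_{w(i)}$. For $w\in S_n$, $R(w)=\{\alpha\in R^+\mid w\alpha\in-R^+\}=\{\varepsilon_j-\varepsilon_i\mid i<j,\ w(j)<w(i)\}$. For $\gamma=\sum_i\gamma_i\varepsilon_i\in\mathbb R^n$ with $\gamma_1\le\cdots\le\gamma_n$, $$Z(\gamma)=\{\alpha\in R^+\mid\langle\gamma,\alpha\rangle=0\},\qquad P(\gamma)=\{\alpha\in R^+\mid\langle\gamma,\alpha\rangle=1\},$$ and for $J\subseteq P(\gamma)$, $\mathcal F^{(\gamma,J)}=\{w\in S_n\mid R(w)\cap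 Z(\gamma)=\emptyset,\ R(w)\cap P(\gamma)=J\}$. Skew shapes: for partitions $\mu\subseteq\lambda$ (drawn with rows numbered top to bottom and columns left to right, as for matrices), the skew shape $\lambda/\mu$ is the set of boxes of $\lambda$ not in $\mu$. A standard tableau of shape $\lambda/\mu$ ($n$ boxes) is a bijective filling $p$ of the boxes with $1,\dots,n$ increasing left to right in each row and top to bottom in each column. A diagonal is a set of positions with constant (column $-$ row). A placed skew shape is a skew shape placed on infinite graph paper whose diagonals are indexed consecutively by $\mathbb Z$ from southwest to northeast; the content $c(b)$ of a box is the index of its diagonal (so $c(b)=\text{column}(b)-\text{row}(b)+s$ for a fixed integer $s$). The boxes are numbered $\mathrm{box}_1,\dots,\mathrm{box}_n$ along diagonals from southwest to northeast, and within each diagonal from northwest to southeast. Then $\gamma=(c(\mathrm{box}_1),\dots,c(\mathrm{box}_n))=\sum_ic(\mathrm{box}_i)\varepsilon_i$, and the pair $(\gamma,\lambda/\mu)$ denotes the placed skew shape. Two diagonals are adjacent if their indices differ by $1$. *)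

(* Defs.v *)
From HB Require Import structures.
From mathcomp Require Import all_boot all_order all_algebra all_fingroup.
From mathcomp Require Import finmap.
From mathcomp Require Import boolp classical_sets functions reals.

Set Implicit Arguments.
Unset Strict Implicit.
Unset Printing Implicit Defensive.

Import Order.TTheory GRing.Theory Num.Theory.
Local Open Scope classical_set_scope.
Local Open Scope ring_scope.

(* Indices, tableau entries, rows and columns all count from 0: {1, ..., n}    *)
(* becomes 'I_n.                                                              *)

Section RootSystem.
Context (R : realType) (n : nat).
Implicit Types (v a g : 'rV[R]_n) (w : 'S_n) (J : set 'rV[R]_n).

Definition eps (i : 'I_n) : 'rV[R]_n := delta_mx 0 i.

Definition dotv v a : R := \sum_(i < n) v 0 i * a 0 i.

Definition act w v : 'rV[R]_n := \sum_(i < n) v 0 i *: eps (w i).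

Lemma act_eps w i : act w (eps i) = eps (w i).
Proof.
rewrite /act (bigD1 i) //= big1 ?addr0 => [|k /negPf ki]; rewrite mxE eqxx /=.
  by rewrite eqxx scale1r.
by rewrite ki scale0r.
Qed.

Definition pos_roots : set 'rV[R]_n :=
  [set a | exists i j : 'I_n, (i < j)%N /\ a = eps j - eps i].

Definition neg_roots : set 'rV[R]_n := [set - a | a in pos_roots].

Definition inversions w : set 'rV[R]_n :=
  [set a | pos_roots a /\ neg_roots (act w a)].

Definition zero_roots g : set 'rV[R]_n :=
  [set a | pos_roots a /\ dotv g a = 0].

Definition one_roots g : set 'rV[R]_n :=
  [set a | pos_roots a /\ dotv g a = 1].

Definition local_region g J : set 'S_n :=
  [set w | inversions w `&` zero_roots g = set0 /\
           inversions w `&` one_roots g = J].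

End RootSystem.

Definition is_partition (la : seq nat) : bool :=
  sorted geq la && (0%N \notin la).

(* A box is a pair (row, column); rows are counted from north to south and    *)
(* columns from west to east.                                                 *)
Definition young (la : seq nat) : {fset nat * nat} :=
  [fset b in [seq (r, c) | r <- iota 0 (size la), c <- iota 0 (nth 0%N la r)]]%fset.

Lemma in_young (la : seq nat) (r c : nat) :
  ((r, c) \in young la) = (c < nth 0%N la r)%N.
Proof.
rewrite /young !inE; apply/allpairsPdep/idP => [[r' [c' [_ + [-> ->]]]]|rc].
  by rewrite mem_iota.
exists r, c; rewrite !mem_iota /=; split=> //.
by rewrite ltnNge; apply/negP => /(nth_default 0%N) e; rewrite e ltn0 in rc.
Qed.

Record placed_skew_shape := PlacedSkewShape {
  lambda : seq nat;
  mu : seq nat;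
  shift : int;
  lambda_partition : is_partition lambda;
  mu_partition : is_partition mu;
  mu_sub_lambda : (young mu `<=` young lambda)%fset
}.

Section SkewShape.
Context (S : placed_skew_shape).

Definition skew : {fset nat * nat} :=
  (young (lambda S) `\` young (mu S))%fset.

Local Notation n := #|{: skew}|.

Definition row_of (b : skew) : nat := (val b).1.
Definition col_of (b : skew) : nat := (val b).2.

Definition content (b : skew) : int :=
  (col_of b)%:Z - (row_of b)%:Z + shift S.

Definition box_le (b b' : skew) : bool :=
  (content b < content b') ||
  ((content b == content b') && (row_of b <= row_of b')%N).

Definition box_seq : seq skew := sort box_le (enum {: skew}).

Lemma size_box_seq : size box_seq == n.
Proof. by rewrite size_sort -cardE. Qed.

Definition box (i : 'I_n) : skew := tnth (Tuple size_box_seq) i.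

Definition adjacent_diagonals (b b' : skew) : bool :=
  `|content b - content b'| == 1.

Definition northwest (b b' : skew) : bool :=
  (row_of b < row_of b')%N && (col_of b <= col_of b')%N.

Definition standard (p : {ffun skew -> 'I_n}) : bool :=
  [&& injectiveb p,
      [forall b, forall b',
         (row_of b == row_of b') && (col_of b < col_of b')%N ==>
         (p b < p b')%N] &
      [forall b, forall b',
         (col_of b == col_of b') && (row_of b < row_of b')%N ==>
         (p b < p b')%N]].

(* An injection between the boxes and 'I_n is a bijection by cardinality.     *)
Definition standard_tableau : Type := {p : {ffun skew -> 'I_n} | standard p}.

Lemma box_le_total : total box_le.
Proof.
move=> b b'; rewrite /box_le.
by case: (ltgtP (content b) (content b')) => //= _; exact: leq_total.
Qed.

Lemma box_le_trans : transitive box_le.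
Proof.
move=> b a c; rewrite /box_le.
case/orP=> [ab|/andP[/eqP -> ab]]; case/orP=> [bc|/andP[/eqP <- bc]].
- by rewrite (lt_trans ab bc).
- by rewrite ab.
- by rewrite bc.
- by rewrite eqxx (leq_trans ab bc) orbT.
Qed.

Lemma box_inj : injective box.
Proof.
move=> i j /eqP; rewrite /box !(tnth_nth (box i)) /= nth_uniq.
- by move/eqP/val_inj.
- by rewrite (eqP size_box_seq).
- by rewrite (eqP size_box_seq).
- by rewrite sort_uniq enum_uniq.
Qed.

Lemma box_sorted (i j : 'I_n) : (i < j)%N -> box_le (box i) (box j).
Proof.
move=> ij; rewrite /box !(tnth_nth (box i)) /=.
apply: (sorted_ltn_nth box_le_trans) => //.
- exact: (sort_sorted box_le_total).
- by rewrite inE (eqP size_box_seq).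
- by rewrite inE (eqP size_box_seq).
Qed.

Lemma tableau_perm_inj (p : standard_tableau) :
  injective (fun i : 'I_n => val p (box i)).
Proof.
case: p => p /= /andP[/injectiveP pinj _] i j /pinj.
exact: box_inj.
Qed.

Definition tableau_perm (p : standard_tableau) : 'S_n :=
  perm (@tableau_perm_inj p).

Lemma tableau_permE (p : standard_tableau) (i : 'I_n) :
  tableau_perm p i = val p (box i).
Proof. by rewrite permE. Qed.

Context (R : realType).

Definition gamma : 'rV[R]_n := \row_(i < n) (content (box i))%:~R.

Definition shape_J : set 'rV[R]_n :=
  [set a | exists i j : 'I_n,
     [/\ (i < j)%N, adjacent_diagonals (box j) (box i),
         northwest (box j) (box i) & a = eps R j - eps R i]].

(* The standing conditions on a pair (gamma, J) hold for those of a shape.    *)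
Lemma gamma_nondecreasing (i j : 'I_n) :
  (i <= j)%N -> gamma 0 i <= gamma 0 j.
Proof.
rewrite leq_eqVlt => /orP[/eqP/val_inj -> //|/box_sorted].
rewrite !mxE ler_int /box_le => /orP[/ltW //|/andP[/eqP -> _]].
exact: lexx.
Qed.

Lemma dotv_eps (v : 'rV[R]_n) (i j : 'I_n) :
  dotv v (eps R j - eps R i) = v 0 j - v 0 i.
Proof.
rewrite /dotv.
under eq_bigr do rewrite !mxE eqxx /= mulrBr.
rewrite sumrB (bigD1 j) //= [X in _ - X](bigD1 i) //= !eqxx !mulr1.
by rewrite !big1 ?addr0 // => k /negPf ->; rewrite mulr0.
Qed.

Lemma shape_J_sub : shape_J `<=` one_roots gamma.
Proof.
move=> a [i [j [ij adj _ ->]]]; split; first by exists i, j.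
rewrite dotv_eps; have := gamma_nondecreasing (ltnW ij).
rewrite !mxE ler_int -intrB => le_ij.
by move: adj; rewrite /adjacent_diagonals ger0_norm ?subr_ge0 // => /eqP ->.
Qed.

End SkewShape.

Arguments gamma : clear implicits.
Arguments shape_J : clear implicits.

(* Main.v *)
Require Import Defs.
From mathcomp Require Import all_boot all_order all_algebra all_fingroup.
From mathcomp Require Import boolp classical_sets functions reals.
From mathcomp Require Import finmap zify lra.

(** A skew shape is convex: with two boxes it contains the whole rectangle
    they span, so in a standard tableau entries increase from a box to any box
    weakly southeast of it.  Two boxes on the same or on adjacent diagonals are
    always comparable in this way, which determines exactly the inversions of
    [w_p] at roots of [Z(gamma)] and [P(gamma)].  Conversely, horizontally or
    vertically adjacent boxes lie on adjacent diagonals, so the conditions on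
    [P(gamma)] force the filling to increase along rows and columns. *)

Set Implicit Arguments.
Unset Strict Implicit.
Unset Printing Implicit Defensive.

Import Defs.
Import Order.TTheory GRing.Theory Num.Theory.
Local Open Scope classical_set_scope.
Local Open Scope ring_scope.

(** * Inversions at the roots [eps R j - eps R i] *)

Section Roots.
Context (R : realType) (n : nat).
Implicit Types (g : 'rV[R]_n) (w : 'S_n) (J : set 'rV[R]_n).

(** Compare coordinates [i] and [j]: the left side is -1 at [i] and 1 at [j], values the right side
    takes only at [k] and [l] respectively. *)
Lemma eps_sub_inj (i j k l : 'I_n) :
  i != j -> eps R j - eps R i = eps R l - eps R k -> i = k /\ j = l.
Proof.
move=> ij /matrixP e.
have := e 0 j; have := e 0 i; rewrite !mxE !eqxx /= (eq_sym j i) (negPf ij).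
have [->|_] := eqVneq i k; have [->|_] := eqVneq j l => //;
  case: (i == l); case: (j == k) => /= ? ?; exfalso; lra.
Qed.

Lemma dotv_eps_sub g (i j : 'I_n) :
  dotv g (eps R j - eps R i) = g 0 j - g 0 i.
Proof.
have dotv_eps1 k : \sum_(l < n) g 0 l * eps R k 0 l = g 0 k.
  rewrite (bigD1 k) //= big1 ?addr0 => [|l /negPf lk]; rewrite mxE eqxx /=.
    by rewrite eqxx mulr1.
  by rewrite lk mulr0.
rewrite -[in RHS](dotv_eps1 i) -[in RHS](dotv_eps1 j) -sumrB.
by apply: eq_bigr => l _; rewrite !mxE mulrBr.
Qed.

Lemma act_eps_sub w (i j : 'I_n) :
  act w (eps R j - eps R i) = eps R (w j) - eps R (w i).
Proof.
rewrite -!act_eps /act -sumrB; apply: eq_bigr => k _.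
by rewrite -scalerBl !mxE.
Qed.

Lemma inversions_eps_sub w (i j : 'I_n) : (i < j)%N ->
  inversions w (eps R j - eps R i) <-> (w j < w i)%N.
Proof.
move=> ij; rewrite /inversions /neg_roots /= act_eps_sub; split.
  case=> _ [_ [k [l [kl ->]]]]; rewrite opprB => /esym e.
  have wij : w i != w j by rewrite (inj_eq perm_inj) neq_ltn ij.
  by have [-> ->] := eps_sub_inj wij e.
move=> wji; split; first by exists i, j.
by exists (eps R (w i) - eps R (w j)); [exists (w j), (w i) | rewrite opprB].
Qed.

(** Positive roots are indexed by pairs [i < j], so both set equations can be tested pair by pair.
    The inclusion hypothesis makes every element of [J] such a root. *)
Lemma local_regionP g J w : J `<=` one_roots g ->
  local_region g J w <->
  forall i j : 'I_n, (i < j)%N ->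
    (g 0 j - g 0 i = 0 -> (w i < w j)%N) /\
    (g 0 j - g 0 i = 1 -> (w j < w i)%N <-> J (eps R j - eps R i)).
Proof.
move=> Jone; split=> [[Z P] i j ij|H].
  have posij : pos_roots (eps R j - eps R i) by exists i, j.
  split=> gij.
    rewrite ltnNge leq_eqVlt; apply/negP => /orP[/eqP/val_inj/perm_inj e|wji].
      by rewrite e ltnn in ij.
    (* [False] is read as membership in the empty set, which [Z] then replaces by the
       intersection. *)
    rewrite -[False]/(set0 (eps R j - eps R i)) -Z.
    by split; [exact/inversions_eps_sub | split; rewrite ?dotv_eps_sub].
  rewrite -P; split=> [wji|[/inversions_eps_sub -> //]].
  by split; [exact/inversions_eps_sub | split; rewrite ?dotv_eps_sub].
split; apply/seteqP; split=> a //=.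
- case=> inva [[i [j [ij aE]]]]; rewrite aE dotv_eps_sub => /(proj1 (H i j ij)) wij.
  by move: inva; rewrite aE => /(inversions_eps_sub _ ij) /(ltn_trans wij); rewrite ltnn.
- case=> inva [[i [j [ij aE]]]]; rewrite aE dotv_eps_sub => /(proj2 (H i j ij)) <-.
  by move: inva; rewrite aE => /(inversions_eps_sub _ ij).
- move=> Ja; have onea := Jone _ Ja; split=> //.
  case: onea Ja => -[i [j [ij ->]]]; rewrite dotv_eps_sub.
  by move=> /(proj2 (H i j ij)) <- ?; exact/inversions_eps_sub.
Qed.

End Roots.

Lemma partition_nth_geq (la : seq nat) (r s : nat) :
  is_partition la -> (r <= s)%N -> (nth 0%N la s <= nth 0%N la r)%N.
Proof.
move=> /andP[la_sorted _] rs.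
(* Beyond the last part, the default 0 is below everything. *)
have [sla|/(nth_default 0%N) -> //] := ltnP s (size la).
have geq_trans : transitive geq by move=> x y z /= xy yz; exact: leq_trans yz xy.
by apply: (sorted_leq_nth geq_trans leqnn) => //; rewrite inE; lia.
Qed.

(** * Geometry of the boxes and their contents *)

Section Boxes.
Context (S : placed_skew_shape).
Local Notation n := #|{: skew S}|.
Implicit Types (b : skew S).

Lemma in_skew (r c : nat) : ((r, c) \in skew S) =
  (nth 0%N (mu S) r <= c < nth 0%N (lambda S) r)%N.
Proof. by rewrite /skew in_fsetD !in_young -leqNgt. Qed.

(** Parts decrease weakly: row [r] of [mu] ends no later than that of [b], and row [r] of [lambda]
    no earlier than that of [b']. *)
Lemma skew_convex b b' (r c : nat) :
  (row_of b <= r <= row_of b')%N -> (col_of b <= c <= col_of b')%N ->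
  exists b'', row_of b'' = r /\ col_of b'' = c.
Proof.
case: b b' => -[rb cb] + [[rb' cb'] +]; rewrite /row_of /col_of /=.
rewrite !in_skew => hb hb' /andP[r1 r2] /andP[c1 c2].
have rc : (r, c) \in skew S.
  rewrite in_skew; have := partition_nth_geq (mu_partition S) r1.
  by have := partition_nth_geq (lambda_partition S) r2; lia.
by exists [` rc]%fset.
Qed.

Lemma box_coord_inj b b' :
  row_of b = row_of b' -> col_of b = col_of b' -> b = b'.
Proof. by case: b b' => -[r c] ? [[r' c'] ?] /= e f; apply/val_inj/pair_equal_spec. Qed.

Lemma box_bij : bijective (@box S).
Proof. by apply: inj_card_bij; [exact: box_inj | rewrite card_ord]. Qed.

Lemma ltn_box (i j : 'I_n) :
  content (box i) < content (box j) -> (i < j)%N.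
Proof.
move=> cij; rewrite ltnNge leq_eqVlt; apply/negP.
move=> /orP[/eqP/val_inj e|/box_sorted]; first by rewrite e ltxx in cij.
by rewrite /box_le; lia.
Qed.

(** When the content grows by exactly 1, being strictly north already forces being weakly west. *)
Lemma shape_J_eps_sub (R : realType) (i j : 'I_n) :
  content (box j) = content (box i) + 1 ->
  shape_J S R (eps R j - eps R i) <-> (row_of (box j) < row_of (box i))%N.
Proof.
move=> cij; have ij : (i < j)%N by apply: ltn_box; lia.
split=> [[k [l [kl _ /andP[lk _] /eps_sub_inj[]]]]|rji].
- by rewrite neq_ltn ij.
- by move=> -> ->.
exists i, j; split=> //; first by rewrite /adjacent_diagonals; lia.
by rewrite /northwest rji /=; move: cij; rewrite /content; lia.
Qed.

Lemma shape_local_regionP (R : realType) (w : 'S_n) :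
  local_region (gamma S R) (shape_J S R) w <->
  forall i j : 'I_n,
    (content (box j) = content (box i) -> (i < j)%N -> (w i < w j)%N) /\
    (content (box j) = content (box i) + 1 ->
       (w j < w i)%N = (row_of (box j) < row_of (box i))%N).
Proof.
rewrite (local_regionP _ (@shape_J_sub S R)).
(* Integers embed injectively in [R], so the equations of Z ([z = 0]) and P ([z = 1]) become
   equations between contents. *)
have gE (i j : 'I_n) (z : int) : gamma S R 0 j - gamma S R 0 i = z%:~R <->
    content (box j) = content (box i) + z.
  rewrite !mxE -intrB; split=> [/intr_inj|->]; first by lia.
  by congr (_%:~R); lia.
split=> H i j => [|ij].
  split=> [cij ij|cij].
    by apply: (proj1 (H i j ij)); apply/(gE _ _ 0); rewrite addr0.
  have ij : (i < j)%N by apply: ltn_box; lia.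
  apply/idP/idP; have /(gE _ _ 1)/(proj2 (H i j ij)) := cij;
    by rewrite shape_J_eps_sub // => ->.
split=> [/(gE _ _ 0)|/(gE _ _ 1) cij].
  by rewrite addr0 => /(proj1 (H i j)); apply.
by rewrite shape_J_eps_sub // (proj2 (H i j)).
Qed.

Lemma standard_ltn (p : {ffun skew S -> 'I_n}) b b' : standard p ->
  (row_of b <= row_of b')%N -> (col_of b <= col_of b')%N -> b != b' ->
  (p b < p b')%N.
Proof.
move=> /and3P[_ /forallP rowp /forallP colp] rbb' cbb' bb'.
(* Pass through the northeast corner [m] of the rectangle: along the row of [b], then down the
   column of [b']. *)
have [||m [mr mc]] := @skew_convex b b' (row_of b) (col_of b'); try lia.
have ltrow : b != m -> (p b < p m)%N.
  move=> bm; have /forallP/(_ m)/implyP := rowp b; apply.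
  rewrite mr mc eqxx /= ltn_neqAle cbb' andbT.
  by apply: contra_neq bm => e; apply: box_coord_inj; rewrite ?mr ?mc.
have ltcol : m != b' -> (p m < p b')%N.
  move=> mb'; have /forallP/(_ b')/implyP := colp m; apply.
  rewrite mr mc eqxx /= ltn_neqAle rbb' andbT.
  by apply: contra_neq mb' => e; apply: box_coord_inj; rewrite ?mr ?mc.
have [bm|/ltrow ltbm] := eqVneq b m; first by rewrite bm ltcol // -bm.
by have [<-//|/ltcol] := eqVneq m b'; exact: ltn_trans.
Qed.

(** Induction on the column distance, written [k.+1] so that the base case is a single step;
    convexity supplies the intermediate boxes. *)
Lemma row_ltn_of_step (f : skew S -> nat) b b' :
  (forall x y, row_of y = row_of x -> col_of y = (col_of x).+1 -> (f x < f y)%N) ->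
  row_of b = row_of b' -> (col_of b < col_of b')%N -> (f b < f b')%N.
Proof.
move=> step rbb' cbb'.
have [k] : exists k, col_of b' = (col_of b + k.+1)%N
  by exists (col_of b' - (col_of b).+1)%N; lia.
elim: k b' rbb' {cbb'} => [|k IHk] b' rbb' cb'; first by apply: step; lia.
have [||m [mr mc]] := @skew_convex b b' (row_of b) (col_of b + k.+1); try lia.
by apply: ltn_trans (IHk m _ _) (step _ _ _ _); lia.
Qed.

Lemma col_ltn_of_step (f : skew S -> nat) b b' :
  (forall x y, col_of y = col_of x -> row_of y = (row_of x).+1 -> (f x < f y)%N) ->
  col_of b = col_of b' -> (row_of b < row_of b')%N -> (f b < f b')%N.
Proof.
move=> step cbb' rbb'.
have [k] : exists k, row_of b' = (row_of b + k.+1)%N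
  by exists (row_of b' - (row_of b).+1)%N; lia.
elim: k b' cbb' {rbb'} => [|k IHk] b' cbb' rb'; first by apply: step; lia.
have [||m [mr mc]] := @skew_convex b b' (row_of b + k.+1) (col_of b); try lia.
by apply: ltn_trans (IHk m _ _) (step _ _ _ _); lia.
Qed.

(** * The two directions of the bijection *)

Lemma tableau_perm_local_region (R : realType) (p : standard_tableau S) :
  local_region (gamma S R) (shape_J S R) (tableau_perm p).
Proof.
apply/shape_local_regionP => i j; rewrite !tableau_permE.
have ltp := @standard_ltn _ _ _ (valP p).
split=> [cij ij|cij].
  have := box_sorted ij; rewrite /box_le cij ltxx eqxx /= => rij.
  apply: ltp => //; first by move: cij; rewrite /content; lia.
  by rewrite (inj_eq (@box_inj S)) neq_ltn ij.
have ij : box i != box j by apply/eqP => e; move: cij; rewrite e; lia.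
move: cij; rewrite /content => cij.
(* Since [box j] is one diagonal further northeast, it is either weakly northwest of [box i] or
   weakly southeast of it. *)
have [rji|rij] := ltnP (row_of (box j)) (row_of (box i)).
  by apply: ltp; [lia | lia | rewrite eq_sym].
by apply/negbTE; rewrite -leqNgt ltnW //; apply: ltp => //; lia.
Qed.

Lemma tableau_perm_injective : injective (@tableau_perm S).
Proof.
move=> p q pq; apply/val_inj/ffunP => b; have [box' _ box'K] := box_bij.
by rewrite -(box'K b) -!tableau_permE pq.
Qed.

Lemma tableau_perm_surjective (R : realType) (w : 'S_n) :
  local_region (gamma S R) (shape_J S R) w -> exists p, tableau_perm p = w.
Proof.
move=> /shape_local_regionP Hw; have [box' boxK box'K] := box_bij.
pose p : {ffun skew S -> 'I_n} := [ffun b => w (box' b)].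
have adj x y : content y = content x + 1 ->
    (p y < p x)%N = (row_of y < row_of x)%N.
  by rewrite !ffunE -{1 3}(box'K x) -{1 3}(box'K y) => /(proj2 (Hw _ _)).
have pinj : injective p.
  by move=> x y; rewrite !ffunE => /perm_inj /(can_inj box'K).
have p_std : standard p.
  apply/and3P; split; first exact/injectiveP.
  - apply/forallP => b; apply/forallP => b'; apply/implyP => /andP[/eqP rbb' cbb'].
    apply: (@row_ltn_of_step (fun b => p b)) => // x y rxy cxy.
    have xy : p x != p y by apply/eqP => /pinj e; move: cxy; rewrite e; lia.
    (* A step east raises the content by 1 within a row, so [adj] only excludes [p y < p x];
       injectivity makes the inequality strict. *)
    rewrite ltn_neqAle xy leqNgt adj ?rxy ?ltnn //.
    by rewrite /content; lia.
  - apply/forallP => b; apply/forallP => b'; apply/implyP => /andP[/eqP cbb' rbb'].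
    apply: (@col_ltn_of_step (fun b => p b)) => // x y cxy rxy.
    (* A step south lowers the content by 1, so [adj] applies with [x] and [y] exchanged. *)
    by rewrite adj ?rxy //; rewrite /content; lia.
exists (Sub p p_std); apply/permP => i.
by rewrite tableau_permE /= ffunE boxK.
Qed.

End Boxes.

Theorem theorem5p9 (R : realType) (S : placed_skew_shape) :
  set_bij (@setT (standard_tableau S))
          (local_region (gamma S R) (shape_J S R))
          (@tableau_perm S).
Proof.
split=> [p _|p q _ _|w /tableau_perm_surjective [p <-]].
- exact: tableau_perm_local_region.
- exact: tableau_perm_injective.
- by exists p.
Qed.
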